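(* Let $A, B \in M_4(\mathbb{C})$ satisfy $\operatorname{Tr}(A) = \operatorname{Tr}(B) = 0$ and $\|A\|_F^2 + \|B\|_F^2 = \frac{1}{4}$, and suppose that there is a unitary $U \in M_4(\mathbb{C})$ such that either $B = -UA^TU^*$ or $B = -UAU^*$. Let $X = A \otimes I_4 + I_4 \otimes B \in M_{16}(\mathbb{C})$. Then $$\sigma_1(X)^2 + \sigma_2(X)^2 \leq \frac{1}{2},$$ where $\sigma_1(X) \ge \sigma_2(X)$ are the largest and second-largest singular values of $X$.
   Context: $\|\cdot\|_F$ denotes the Frobenius norm, $\|A\|_F = (\operatorname{Tr}(A^*A))^{1/2}$. $\otimes$ denotes the Kronecker product and $A^T$ the transpose of $A$. *)

(* Defs.v *)
(* complex numbers are R[i] (mathcomp-real-closed) over a realType R. *)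
From HB Require Import structures.
From mathcomp Require Import all_boot all_order all_algebra.
From mathcomp Require Import complex mxtens reals.
Set Implicit Arguments. Unset Strict Implicit. Unset Printing Implicit Defensive.
Import Order.TTheory GRing.Theory Num.Theory.
Local Open Scope ring_scope.

(* conjugate transpose A^* *)
Definition adjmx (R : realType) (m n : nat) (A : 'M[R[i]]_(m, n)) : 'M[R[i]]_(n, m) :=
  (map_mx (fun x : R[i] => x^*) A)^T.

(* squared Frobenius norm: ||A||_F^2 = Tr(A^* A) *)
Definition frob2 (R : realType) (m n : nat) (A : 'M[R[i]]_(m, n)) : R[i] :=
  \tr (adjmx A *m A).

Definition unitary (R : realType) (n : nat) (U : 'M[R[i]]_n) : Prop :=
  U *m adjmx U = 1%:M.

(* [s] is the list of all singular values of X, with multiplicity, in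
   nonincreasing order: the nonnegative reals whose squares are the
   eigenvalues (roots of the characteristic polynomial, with multiplicity)
   of X^* X. *)
Definition singular_values (R : realType) (n : nat) (X : 'M[R[i]]_n) (s : seq R) : Prop :=
  [/\ size s = n,
      all (fun x => 0 <= x) s,
      sorted (fun x y => y <= x) s &
      char_poly (adjmx X *m X) = \prod_(x <- s) ('X - (real_complex R (x ^+ 2))%:P)].

(* Main.v *)
(* Reading a vector of C^4 (x) C^4 as a 4 x 4 matrix W, X becomes
   W |-> A W + W B^T.  Up to right multiplications by unitaries this is
   V |-> A V - V A when B = - U A^T U^*, and V |-> A V - V A^T when
   B = - U A U^*.  Both maps have squared operator norm at most
   2 ||A||_F^2 = ||A||_F^2 + ||B||_F^2 = 1/4, so every singular value of X is at
   most 1/2.  For the commutator this is the Boettcher-Wenzel inequality.  The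
   twisted commutator exchanges symmetric and skew matrices; on a skew K it is
   A K + (A K)^T, and 2 ||A K||_F^2 <= ||A||_F^2 ||K||_F^2 because the singular
   values of K come in pairs; the symmetric case follows by duality. *)
Require Import Defs.
From HB Require Import structures.
From mathcomp Require Import all_boot all_order all_algebra.
From mathcomp Require Import complex mxtens reals.
From mathcomp Require Import ring lra.
Import Order.TTheory GRing.Theory Num.Theory.
Local Open Scope ring_scope.

(** * Conjugate transpose and Frobenius norm *)

Lemma adjmxE {R : realType} {m n} (A : 'M[R[i]]_(m, n)) i j :
  adjmx A i j = (A j i)^*.
Proof. by rewrite !mxE. Qed.

Lemma adjmxK {R : realType} {m n} (A : 'M[R[i]]_(m, n)) : adjmx (adjmx A) = A.
Proof. by apply/matrixP => i j; rewrite !adjmxE conjCK. Qed.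

Lemma adjmxD {R : realType} {m n} (A B : 'M[R[i]]_(m, n)) :
  adjmx (A + B) = adjmx A + adjmx B.
Proof. by apply/matrixP => i j; rewrite !mxE rmorphD. Qed.

Lemma adjmxN {R : realType} {m n} (A : 'M[R[i]]_(m, n)) : adjmx (- A) = - adjmx A.
Proof. by apply/matrixP => i j; rewrite !mxE rmorphN. Qed.

Lemma adjmxZ {R : realType} {m n} (c : R[i]) (A : 'M[R[i]]_(m, n)) :
  adjmx (c *: A) = c^* *: adjmx A.
Proof. by apply/matrixP => i j; rewrite !mxE rmorphM. Qed.

Lemma adjmx_scalar {R : realType} {n} (c : R[i]) :
  adjmx (c%:M : 'M[R[i]]_n) = (c^*)%:M.
Proof.
by apply/matrixP => i j; rewrite !mxE [j == i]eq_sym; case: eqP; rewrite ?rmorph0.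
Qed.

Lemma adjmxM {R : realType} {m n p} (A : 'M[R[i]]_(m, n)) (B : 'M[R[i]]_(n, p)) :
  adjmx (A *m B) = adjmx B *m adjmx A.
Proof. by rewrite /adjmx map_mxM trmx_mul. Qed.

Lemma adjmx_tr {R : realType} {m n} (A : 'M[R[i]]_(m, n)) : adjmx A^T = (adjmx A)^T.
Proof. by apply/matrixP => i j; rewrite !mxE. Qed.

Lemma frob2E {R : realType} {m n} (A : 'M[R[i]]_(m, n)) :
  frob2 A = \sum_i \sum_j `|A i j| ^+ 2.
Proof.
rewrite /frob2 /mxtrace exchange_big; apply: eq_bigr => j _.
by rewrite mxE; apply: eq_bigr => i _; rewrite adjmxE normCK mulrC.
Qed.

Lemma frob2_ge0 {R : realType} {m n} (A : 'M[R[i]]_(m, n)) : 0 <= frob2 A.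
Proof.
by rewrite frob2E; do 2![apply: sumr_ge0 => ? _]; rewrite exprn_ge0.
Qed.

Lemma frob2_eq0 {R : realType} {m n} (A : 'M[R[i]]_(m, n)) :
  frob2 A = 0 -> A = 0.
Proof.
have ge2 i : 0 <= \sum_j `|A i j| ^+ 2.
  by apply: sumr_ge0 => ? _; rewrite exprn_ge0.
rewrite frob2E => /eqP; rewrite psumr_eq0 => [|i _]; last exact: ge2.
move=> /allP A0; apply/matrixP => i j; rewrite mxE.
have := A0 i (mem_index_enum i); rewrite psumr_eq0 => [|k _]; last first.
  by rewrite exprn_ge0.
move=> /allP/(_ j (mem_index_enum j)).
by rewrite /= expf_eq0 /= normr_eq0 => /eqP.
Qed.

Lemma frob2_gt0 {R : realType} {m n} (A : 'M[R[i]]_(m, n)) :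
  A != 0 -> 0 < frob2 A.
Proof.
move=> A0; rewrite lt_def frob2_ge0 andbT; apply: contra_neq A0; exact: frob2_eq0.
Qed.

Lemma frob2_adj {R : realType} {m n} (A : 'M[R[i]]_(m, n)) :
  frob2 (adjmx A) = frob2 A.
Proof. by rewrite /frob2 adjmxK mxtrace_mulC. Qed.

Lemma frob2_tr {R : realType} {m n} (A : 'M[R[i]]_(m, n)) : frob2 A^T = frob2 A.
Proof. by rewrite /frob2 adjmx_tr -trmx_mul mxtrace_tr mxtrace_mulC. Qed.

Lemma frob2Z {R : realType} {m n} (c : R[i]) (A : 'M[R[i]]_(m, n)) :
  frob2 (c *: A) = `|c| ^+ 2 * frob2 A.
Proof.
by rewrite /frob2 adjmxZ -scalemxAr -scalemxAl scalerA mxtraceZ -normCK.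
Qed.

Lemma frob2N {R : realType} {m n} (A : 'M[R[i]]_(m, n)) : frob2 (- A) = frob2 A.
Proof. by rewrite -scaleN1r frob2Z normrN1 expr1n mul1r. Qed.

Lemma frob2D {R : realType} {m n} (A B : 'M[R[i]]_(m, n)) :
  frob2 (A + B) = frob2 A + frob2 B + (\tr (adjmx A *m B) + \tr (adjmx B *m A)).
Proof.
rewrite /frob2 adjmxD mulmxDl !mulmxDr !mxtraceD.
by rewrite [X in _ + X]addrC addrACA.
Qed.

Lemma frob2B {R : realType} {m n} (A B : 'M[R[i]]_(m, n)) :
  frob2 (A - B) = frob2 A + frob2 B - (\tr (adjmx A *m B) + \tr (adjmx B *m A)).
Proof. by rewrite frob2D frob2N adjmxN mulmxN mulNmx !raddfN -opprD. Qed.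

Lemma frob2_parallelogram {R : realType} {m n} (A B : 'M[R[i]]_(m, n)) :
  frob2 (A + B) + frob2 (A - B) = 2 * (frob2 A + frob2 B).
Proof. by rewrite frob2D frob2B addrACA subrr addr0 mulr_natl mulr2n. Qed.

Lemma frob2_mull_isometry {R : realType} {m n p} (U : 'M[R[i]]_(m, n))
    (A : 'M[R[i]]_(n, p)) :
  adjmx U *m U = 1%:M -> frob2 (U *m A) = frob2 A.
Proof. by move=> UU; rewrite /frob2 adjmxM mulmxA -(mulmxA _ _ U) UU mulmx1. Qed.

Lemma frob2_mulr_isometry {R : realType} {m n p} (A : 'M[R[i]]_(m, n))
    (U : 'M[R[i]]_(n, p)) :
  U *m adjmx U = 1%:M -> frob2 (A *m U) = frob2 A.
Proof.
by move=> UU; rewrite -frob2_adj adjmxM frob2_mull_isometry ?frob2_adj ?adjmxK.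
Qed.

Lemma frob2_rowE {R : realType} {m n} (A : 'M[R[i]]_(m, n)) :
  frob2 A = \sum_i frob2 (row i A).
Proof.
rewrite frob2E; apply: eq_bigr => i _; rewrite frob2E big_ord1.
by apply: eq_bigr => j _; rewrite mxE.
Qed.

(** * Commutators and the Boettcher-Wenzel inequality *)

(* The shift is the midpoint of the spectrum: then every shifted eigenvalue is
   at most half the spread (r_max - r_min) in absolute value, and
   (r_max - r_min)^2 <= 2 (r_max^2 + r_min^2) <= 2 frob2 P. *)
Lemma hermitian_shift_bound {R : realType} {n} (P : 'M[R[i]]_n.+1) :
  adjmx P = P ->
  exists a : R, forall m (Y : 'M[R[i]]_(n.+1, m)),
    frob2 ((P - (real_complex R a)%:M) *m Y) <= 2^-1 * frob2 P * frob2 Y.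
Proof.
move=> adjP.
have hermP : P \is hermsymmx.
  apply/is_hermitianmxP; rewrite expr0 scale1r -[LHS]adjP.
  by apply/matrixP => i j; rewrite !mxE.
have /orthomx_spectralP := hermitian_normalmx hermP.
set V := spectralmx P; set d := spectral_diag P.
have /mxOverP dreal := hermitian_spectral_diag_real hermP.
have VV : V *m adjmx V = 1%:M.
  rewrite -(unitarymxP (spectral_unitarymx P)); congr (_ *m _).
  by apply/matrixP => i j; rewrite !mxE.
have VV' : adjmx V *m V = 1%:M by apply: mulmx1C.
have -> : invmx V = adjmx V by rewrite -[LHS]mulmx1 -VV mulKmx ?spectral_unit.
move=> PE; pose r i := complex.Re (d 0 i).
have rE i : d 0 i = real_complex R (r i) by rewrite RRe_real.
pose M := [arg max_(i > ord0) r i]%O; pose N := [arg min_(i < ord0) r i]%O.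
have rM i : r i <= r M by rewrite /M; case: arg_maxP => // j _; apply.
have rN i : r N <= r i by rewrite /N; case: arg_minP => // j _; apply.
have frobP : frob2 P = real_complex R (\sum_i r i ^+ 2).
  rewrite PE -mulmxA frob2_mull_isometry ?adjmxK // frob2_mulr_isometry //.
  rewrite frob2E rmorph_sum; apply: eq_bigr => i _.
  rewrite (bigD1 i) //= big1 => [|j /negPf ji].
    by rewrite mxE eqxx mulr1n rE addr0 real_normK ?rmorphXn // -rE.
  by rewrite mxE eq_sym ji mulr0n normr0 expr0n.
pose a := (r M + r N) / 2; exists a => m Y.
have -> : P - (real_complex R a)%:M =
    adjmx V *m (diag_mx d - (real_complex R a)%:M) *m V.
  by rewrite mulmxBr mulmxBl -PE -scalemx1 -scalemxAr mulmx1 -scalemxAl VV'.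
rewrite -!mulmxA frob2_mull_isometry ?adjmxK //.
rewrite -[frob2 Y](@frob2_mull_isometry _ _ _ _ V) //; move: (V *m Y) => {}Y.
have -> : diag_mx d - (real_complex R a)%:M =
    diag_mx (\row_i real_complex R (r i - a)).
  apply/matrixP => i j; rewrite !mxE -mulrnBl rE rmorphB //.
rewrite frobP mul_diag_mx !frob2E mulr_sumr; apply: ler_sum => i _.
rewrite mulr_sumr; apply: ler_sum => j _.
rewrite !mxE normrM exprMn ler_wpM2r ?exprn_ge0 //.
rewrite real_normK; last by apply/complex_realP; exists (r i - a).
rewrite -rmorphXn.
have -> : 2^-1 = real_complex R 2^-1 by rewrite fmorphV rmorph_nat.
rewrite -rmorphM lecR.
(* If [M = N], every [r i] equals the shift [a]; otherwise the squares at [M] and [N] are two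
   separate terms of the sum. *)
have [MN|MN] := eqVneq M N.
  have -> : r i - a = 0 by have := rM i; have := rN i; rewrite /a MN; lra.
  by rewrite expr0n mulr_ge0 ?invr_ge0 // sumr_ge0 // => k _; rewrite sqr_ge0.
have rMN : r M ^+ 2 + r N ^+ 2 <= \sum_k r k ^+ 2.
  rewrite (bigD1 M) //= (bigD1 N) 1?eq_sym //= addrA lerDl.
  by apply: sumr_ge0 => ? _; rewrite sqr_ge0.
(* This product equals ((r_M - r_N)/2)^2 - (r_i - a)^2. *)
have rNiM : 0 <= (r i - r N) * (r M - r i) by rewrite mulr_ge0 // subr_ge0.
have := sqr_ge0 (r M + r N); rewrite /a; nra.
Qed.

Lemma scale_half_double {R : realType} {m n} (A : 'M[R[i]]_(m, n)) :
  2^-1 *: (A + A) = A.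
Proof. by rewrite -mulr2n -(scaler_nat _ A) scalerA mulVf ?pnatr_eq0 // scale1r. Qed.

(* The positive summand added on the left turns the cross terms into squares;
   after shifting X by a scalar, which does not change the commutator, each
   square is controlled by [hermitian_shift_bound]. *)
Lemma frob2_commutator_anticommutator {R : realType} {n} (Z Y : 'M[R[i]]_n) :
  frob2 (Z *m Y - Y *m Z) + frob2 (adjmx Z *m Y + Y *m adjmx Z) =
  (frob2 (Z *m Y) + frob2 (adjmx Z *m Y)) +
  (frob2 (Y *m Z) + frob2 (Y *m adjmx Z)).
Proof.
rewrite frob2B frob2D !adjmxM !adjmxK.
have -> : \tr (adjmx Y *m adjmx Z *m (Y *m Z)) =
          \tr (Z *m adjmx Y *m (adjmx Z *m Y)).
  by rewrite -!mulmxA [RHS]mxtrace_mulC -!mulmxA.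
have -> : \tr (adjmx Z *m adjmx Y *m (Z *m Y)) =
          \tr (adjmx Y *m Z *m (Y *m adjmx Z)).
  by rewrite -!mulmxA [LHS]mxtrace_mulC -!mulmxA.
rewrite [X in _ - X]addrC.
by rewrite addrACA addNr addr0 addrACA.
Qed.

Lemma cartesian_decomposition {R : realType} {n} (X : 'M[R[i]]_n) :
  exists P Q, [/\ adjmx P = P, adjmx Q = Q & P + 'i *: Q = X].
Proof.
exists (2^-1 *: (X + adjmx X)), ((2^-1 * - 'i) *: (X - adjmx X)); split.
- by rewrite adjmxZ fmorphV rmorph_nat adjmxD adjmxK addrC.
- have conji : (2^-1 * - 'i : R[i])^* = 2^-1 * 'i.
    by rewrite rmorphM /= fmorphV rmorph_nat rmorphN /= conjCi opprK.
  rewrite adjmxZ conji adjmxD adjmxN adjmxK mulrN.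
  by rewrite scaleNr -scalerN opprB.
- rewrite scalerA mulrCA mulrN -expr2 sqrCi opprK mulr1 -scalerDr addrACA subrr.
  by rewrite addr0 scale_half_double.
Qed.

(* Boettcher-Wenzel, by Audenaert's argument. *)
Lemma frob2_commutator_le {R : realType} {n} (X Y : 'M[R[i]]_n) :
  frob2 (X *m Y - Y *m X) <= 2 * frob2 X * frob2 Y.
Proof.
case: n X Y => [|n] X Y.
  by rewrite !frob2E !big_ord0 mulr0.
have [P [Q [adjP adjQ PQD]]] := cartesian_decomposition X.
have PQB : P - 'i *: Q = adjmx X.
  by rewrite -PQD adjmxD adjmxZ adjP adjQ conjCi scaleNr.
have frobi m p (M : 'M[R[i]]_(m, p)) : frob2 ('i *: M) = frob2 M.
  by rewrite frob2Z normCi expr1n mul1r.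
(* Parallelogram law for P + iQ = X and P - iQ = X^*, which have equal norms. *)
have PQ : frob2 P + frob2 Q = frob2 X.
  apply: (@mulfI _ 2); first by rewrite pnatr_eq0.
  rewrite -(frobi _ _ Q) -frob2_parallelogram PQD PQB frob2_adj.
  by rewrite mulr_natl mulr2n.
have [a Ha] := hermitian_shift_bound _ adjP.
have [b Hb] := hermitian_shift_bound _ adjQ.
set H := P - _ in Ha; set K := Q - _ in Hb.
have conjR (r : R) : (real_complex R r)^* = real_complex R r.
  exact: conjc_real.
have adjH : adjmx H = H by rewrite adjmxD adjP adjmxN adjmx_scalar conjR.
have adjK : adjmx K = K by rewrite adjmxD adjQ adjmxN adjmx_scalar conjR.
pose Z := H + 'i *: K.
have adjZ : adjmx Z = H - 'i *: K.
  by rewrite adjmxD adjmxZ adjH adjK conjCi scaleNr.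
have [c XE] : exists c, X = Z + c%:M.
  exists (real_complex R a + 'i * real_complex R b).
  rewrite (raddfD (@scalar_mx _ _)) /= -scale_scalar_mx addrACA -scalerDr.
  by rewrite /H /K !subrK.
have -> : X *m Y - Y *m X = Z *m Y - Y *m Z.
  by rewrite XE mulmxDl mulmxDr scalar_mxC opprD addrACA subrr addr0.
(* The parallelogram law turns the left side into 2(|HY|^2 + |KY|^2); the two shift bounds then add
   up to (|P|^2 + |Q|^2)|Y|^2. *)
have ZY : frob2 (Z *m Y) + frob2 (adjmx Z *m Y) <= frob2 X * frob2 Y.
  rewrite adjZ (mulmxDl H) (mulmxBl H) frob2_parallelogram -scalemxAl frobi -PQ.
  rewrite -ler_pdivlMl // mulrA mulrDr mulrDl.
  exact: lerD (Ha _ Y) (Hb _ Y).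
have YZ : frob2 (Y *m Z) + frob2 (Y *m adjmx Z) <= frob2 X * frob2 Y.
  rewrite adjZ (mulmxDr Y H) (mulmxBr Y H) frob2_parallelogram -scalemxAr frobi -PQ.
  (* Taking adjoints turns right multiplication by the Hermitian H and K into left
     multiplication. *)
  rewrite -(frob2_adj Y) -(frob2_adj (Y *m H)) -(frob2_adj (Y *m K)).
  rewrite !adjmxM adjH adjK.
  rewrite -ler_pdivlMl // mulrA mulrDr mulrDl.
  exact: lerD (Ha _ (adjmx Y)) (Hb _ (adjmx Y)).
apply: (@le_trans _ _ (frob2 (Z *m Y - Y *m Z)
                       + frob2 (adjmx Z *m Y + Y *m adjmx Z))).
  by rewrite lerDl frob2_ge0.
rewrite frob2_commutator_anticommutator -mulrA mulr_natl mulr2n.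
exact: lerD.
Qed.

(** * Twisted commutators *)

(* With u = x K, the rank-two skew matrix L = F - F^T, F = adjmx x *m u, has
   <L, K> = 2 |u|^2 and |L|^2 = 2 |x|^2 |u|^2, since K skew gives x u^T = 0;
   expand | |x|^2 K - L |^2 >= 0. *)
Lemma frob2_row_mul_skew_le {R : realType} {n} (x : 'rV[R[i]]_n)
    (K : 'M[R[i]]_n) :
  K^T = - K -> 2 * frob2 (x *m K) <= frob2 x * frob2 K.
Proof.
move=> skewK; have [->|x0] := eqVneq x 0.
  rewrite mul0mx; have -> : frob2 (0 : 'rV[R[i]]_n) = 0.
    by rewrite /frob2 mulmx0 mxtrace0.
  by rewrite mulr0 mul0r.
set u := x *m K; set F := adjmx x *m u.
(* A 1 x 1 matrix equals its own transpose, so a skew one vanishes. *)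
have uxT : x *m u^T = 0.
  have E : x *m u^T = - (x *m u^T)^T.
    by rewrite [in RHS]trmx_mul trmxK /u trmx_mul skewK mulNmx mulmxN mulmxA.
  apply/rowP => j; have := congr1 (fun M : 'M_1 => M 0 0) E.
  rewrite [j]ord1 !mxE => /eqP; rewrite -addr_eq0 -mulr2n mulrn_eq0 /=.
  by move/eqP.
have frobF : frob2 F = frob2 x * frob2 u.
  rewrite /F /frob2 adjmxM adjmxK -mulmxA (mulmxA x).
  rewrite [x *m adjmx x]mx11_scalar mul_scalar_mx -scalemxAr mxtraceZ.
  by rewrite (mxtrace_mulC (adjmx x)) /mxtrace big_ord1.
have FK : \tr (adjmx F *m K) = frob2 u by rewrite /F adjmxM adjmxK -mulmxA.
have KF : \tr (adjmx K *m F) = frob2 u by rewrite /F mulmxA -adjmxM.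
have FTK : \tr (adjmx F^T *m K) = - frob2 u.
  rewrite adjmx_tr -mxtrace_tr trmx_mul trmxK skewK mulNmx raddfN /=.
  by rewrite mxtrace_mulC FK.
have KFT : \tr (adjmx K *m F^T) = - frob2 u.
  rewrite -mxtrace_tr trmx_mul trmxK -adjmx_tr skewK adjmxN mulmxN raddfN /=.
  by rewrite mxtrace_mulC KF.
have FFT : adjmx F *m F^T = 0.
  by rewrite /F adjmxM adjmxK trmx_mul -mulmxA (mulmxA x) uxT mul0mx mulmx0.
have FTF : \tr (adjmx F^T *m F) = 0.
  rewrite adjmx_tr -mxtrace_tr trmx_mul trmxK mxtrace_mulC FFT.
  by rewrite mxtrace0.
have frobL : frob2 (F - F^T) = 2 * (frob2 x * frob2 u).
  by rewrite frob2B frob2_tr FFT FTF mxtrace0 frobF; ring.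
have a0 := frob2_gt0 _ x0; set a := frob2 x in a0 frobL frobF *.
have aR : a^* = a by apply: conj_Creal; apply: ger0_real; apply: ltW.
have := frob2_ge0 (a *: K - (F - F^T)).
rewrite frob2B frobL frob2Z adjmxZ aR adjmxD adjmxN mulmxBl -!scalemxAl -!scalemxAr.
rewrite mulmxBr scalerBr !raddfB /= !mxtraceZ FK KF FTK KFT.
rewrite gtr0_norm //.
have -> : a ^+ 2 * frob2 K + 2 * (a * frob2 u) -
  (a * frob2 u - a * - frob2 u + (a * frob2 u - a * - frob2 u)) =
  a * (a * frob2 K - 2 * frob2 u) by ring.
by rewrite pmulr_rge0 // subr_ge0.
Qed.

Lemma frob2_mul_skew_le {R : realType} {m n} (A : 'M[R[i]]_(m, n))
    (K : 'M[R[i]]_n) :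
  K^T = - K -> 2 * frob2 (A *m K) <= frob2 A * frob2 K.
Proof.
move=> skewK; rewrite (frob2_rowE (A *m K)) (frob2_rowE A) mulr_sumr mulr_suml.
by apply: ler_sum => i _; rewrite row_mul frob2_row_mul_skew_le.
Qed.

(** Skewness of K turns the map into M + M^T with M = A K, whose squared norm is at most 4|M|^2; the
    gain of 1/2 in [frob2_mul_skew_le] leaves the constant 2. *)
Lemma frob2_twisted_commutator_skew_le {R : realType} {n} (A K : 'M[R[i]]_n) :
  K^T = - K -> frob2 (A *m K - K *m A^T) <= 2 * frob2 A * frob2 K.
Proof.
move=> skewK; have -> : A *m K - K *m A^T = A *m K + (A *m K)^T.
  by rewrite trmx_mul skewK mulNmx.
apply: (@le_trans _ _ (2 * (frob2 (A *m K) + frob2 (A *m K)^T))).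
  by rewrite -frob2_parallelogram lerDl frob2_ge0.
rewrite frob2_tr -mulrA ler_pM2l //.
apply: le_trans (frob2_mul_skew_le A _ skewK).
by rewrite mulr_natl mulr2n.
Qed.

(* The twisted commutator exchanges symmetric and skew matrices, and its adjoint
   is the twisted commutator of [adjmx A]; so its norm on symmetric matrices
   equals the norm of its adjoint on skew ones. *)
Lemma frob2_twisted_commutator_sym_le {R : realType} {n} (A S : 'M[R[i]]_n) :
  S^T = S -> frob2 (A *m S - S *m A^T) <= 2 * frob2 A * frob2 S.
Proof.
move=> symS; have [->|A0] := eqVneq A 0.
  rewrite trmx0 mulmx0 mul0mx subr0.
  by rewrite {1}/frob2 mulmx0 mxtrace0 !mulr_ge0 ?frob2_ge0.
have [Y YE] : exists Y, A *m S - S *m A^T = Y by eexists.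
have skewY : Y^T = - Y.
  by rewrite -YE raddfB /= !trmx_mul symS trmxK opprB.
have := frob2_twisted_commutator_skew_le (adjmx A) _ skewY.
rewrite YE frob2_adj; set Z := _ - _ => HZ.
(* With T the twisted commutator of A, Y = T S and Z = T^* Y, so <S, Z> = <T S, Y> = |Y|^2. *)
have SZ : \tr (adjmx S *m Z) = frob2 Y.
  rewrite /Z /frob2 -[in adjmx Y]YE adjmxD adjmxN !adjmxM adjmx_tr mulmxBr mulmxBl.
  rewrite !raddfB /= !mulmxA; congr (_ - _).
  by rewrite mxtrace_mulC !mulmxA.
have ZS : \tr (adjmx Z *m S) = frob2 Y.
  rewrite /Z /frob2 -{4}YE adjmxD adjmxN !adjmxM adjmx_tr adjmxK mulmxBr mulmxBl.
  rewrite !raddfB /= -!mulmxA; congr (_ - _).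
  by rewrite mxtrace_mulC !mulmxA.
have a0 := frob2_gt0 _ A0; set a := frob2 A in a0 HZ *.
have aR : (2 * a)^* = 2 * a.
  by apply: conj_Creal; apply: ger0_real; rewrite mulr_ge0 // ltW.
(* Expanding gives 4a^2|S|^2 - 4a|Y|^2 + |Z|^2 >= 0, and |Z|^2 <= 2a|Y|^2 by the skew case; dividing
   by 2a leaves the claim. *)
have := frob2_ge0 ((2 * a) *: S - Z).
rewrite frob2B frob2Z adjmxZ aR -scalemxAl -scalemxAr !mxtraceZ SZ ZS.
rewrite gtr0_norm ?mulr_gt0 // => ge0.
have {ge0 HZ}: 0 <= (2 * a) * (2 * a * frob2 S - frob2 Y).
  apply: le_trans ge0 _; rewrite -subr_ge0 in HZ; rewrite -subr_ge0.
  apply: le_trans HZ _; rewrite le_eqVlt; apply/orP; left; apply/eqP; ring.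
by rewrite pmulr_rge0 ?mulr_gt0 // subr_ge0.
Qed.

(** Transposition sends S - K to S + K, so these have equal norms and the parallelogram law
    applies. *)
Lemma frob2_sym_skewD {R : realType} {n} (S K : 'M[R[i]]_n) :
  S^T = S -> K^T = - K -> frob2 (S + K) = frob2 S + frob2 K.
Proof.
move=> symS skewK; apply: (@mulfI _ 2); first by rewrite pnatr_eq0.
rewrite -frob2_parallelogram -[frob2 (S - K)]frob2_tr raddfB /= symS skewK opprK.
by rewrite mulr_natl mulr2n.
Qed.

(** The symmetric and skew parts of W are orthogonal, and so are their images, which are skew and
    symmetric; the two bounds therefore add without loss. *)
Lemma frob2_twisted_commutator_le {R : realType} {n} (A W : 'M[R[i]]_n) :
  frob2 (A *m W - W *m A^T) <= 2 * frob2 A * frob2 W.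
Proof.
pose S := 2^-1 *: (W + W^T); pose K := 2^-1 *: (W - W^T).
have symS : S^T = S by rewrite /S linearZ linearD /= trmxK addrC.
have skewK : K^T = - K by rewrite /K linearZ linearB /= trmxK -scalerN opprB.
have -> : W = S + K.
  by rewrite /S /K -scalerDr addrACA subrr addr0 scale_half_double.
have symT : (A *m K - K *m A^T)^T = A *m K - K *m A^T.
  by rewrite raddfB /= !trmx_mul skewK trmxK mulmxN mulNmx addrC opprK.
have skewT : (A *m S - S *m A^T)^T = - (A *m S - S *m A^T).
  by rewrite raddfB /= !trmx_mul symS trmxK opprB.
have -> : A *m (S + K) - (S + K) *m A^T =
    (A *m K - K *m A^T) + (A *m S - S *m A^T).
  by clearbody S K; rewrite mulmxDr mulmxDl opprD addrACA addrC.
rewrite (frob2_sym_skewD _ _ symT skewT) (frob2_sym_skewD _ _ symS skewK).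
rewrite mulrDr [leRHS]addrC; apply: lerD.
  exact: frob2_twisted_commutator_skew_le.
exact: frob2_twisted_commutator_sym_le.
Qed.

(** * The Kronecker sum as a map on matrices, and its singular values *)

Lemma sum_mxtens_index {R : realType} {m n} (F : 'I_(m * n) -> R[i]) :
  \sum_k F k = \sum_i \sum_j F (mxtens_index (i, j)).
Proof.
rewrite pair_bigA /= (reindex (@mxtens_index m n)).
  by apply: eq_bigr => -[].
exists (@mxtens_unindex m n) => k _; first exact: mxtens_indexK.
exact: mxtens_unindexK.
Qed.

(* Reading vectors of C^m (x) C^n as m x n matrices W turns A (x) 1 + 1 (x) B
   into W |-> A W + W B^T. *)
Lemma frob2_tensor_sum {R : realType} {m n} (A : 'M[R[i]]_m) (B : 'M[R[i]]_n)
    (w : 'cV[R[i]]_(m * n)) :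
  exists2 W : 'M[R[i]]_(m, n), frob2 W = frob2 w &
    frob2 ((A *t (1%:M : 'M_n) + (1%:M : 'M_m) *t B) *m w) =
    frob2 (A *m W + W *m B^T).
Proof.
have frob2v (v : 'cV[R[i]]_(m * n)) :
    frob2 (\matrix_(i < m, j < n) v (mxtens_index (i, j)) 0) = frob2 v.
  rewrite !frob2E sum_mxtens_index; apply: eq_bigr => i _; apply: eq_bigr => j _.
  by rewrite big_ord1 mxE.
exists (\matrix_(i, j) w (mxtens_index (i, j)) 0); first exact: frob2v.
rewrite -frob2v; congr frob2; apply/matrixP => i j.
rewrite mulmxDl !mxE !sum_mxtens_index; congr (_ + _).
  apply: eq_bigr => k _; rewrite (bigD1 j) //= big1 => [|l /negPf lj].
    by rewrite tensmxE !mxE eqxx mulr1 addr0.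
  by rewrite tensmxE !mxE eq_sym lj mulr0 mul0r.
rewrite (bigD1 i) //= [X in _ + X]big1 => [|k /negPf ki].
  by rewrite addr0; apply: eq_bigr => k _; rewrite tensmxE !mxE eqxx mul1r mulrC.
by apply: big1 => l _; rewrite tensmxE !mxE eq_sym ki !mul0r.
Qed.

Lemma frob2_tensor_sum_le {R : realType} {n} (A B : 'M[R[i]]_n)
    (w : 'cV[R[i]]_(n * n)) :
  (exists U : 'M[R[i]]_n, unitary U /\
     (B = - (U *m A^T *m adjmx U) \/ B = - (U *m A *m adjmx U))) ->
  frob2 ((A *t (1%:M : 'M_n) + (1%:M : 'M_n) *t B) *m w) <=
  (frob2 A + frob2 B) * frob2 w.
Proof.
move=> [U [UU BE]].
have U'U : adjmx U *m U = 1%:M by apply: mulmx1C.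
have UTU : U^T *m adjmx U^T = 1%:M by rewrite adjmx_tr -trmx_mul U'U trmx1.
have frobB : frob2 B = frob2 A.
  case: BE => ->; rewrite frob2N frob2_mulr_isometry ?adjmxK //;
    by rewrite frob2_mull_isometry ?frob2_tr.
have [W <- ->] := frob2_tensor_sum A B w.
(* Since U^T is unitary, substituting W = V U^T preserves norms; it also lets U^T factor out on the
   right, leaving a plain or twisted commutator of A with V. *)
have [V ->] : exists V, W = V *m U^T.
  by exists (W *m adjmx U^T); rewrite -mulmxA (mulmx1C UTU) mulmx1.
rewrite frob2_mulr_isometry //.
rewrite frobB -mulr2n -mulr_natl.
case: BE => ->.
  have -> : A *m (V *m U^T) + V *m U^T *m (- (U *m A^T *m adjmx U))^T =
            (A *m V - V *m A) *m U^T.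
    rewrite raddfN /= !trmx_mul -adjmx_tr trmxK mulmxN mulmxBl !mulmxA.
    by rewrite -(mulmxA V) UTU mulmx1.
  by rewrite frob2_mulr_isometry // frob2_commutator_le.
have -> : A *m (V *m U^T) + V *m U^T *m (- (U *m A *m adjmx U))^T =
          (A *m V - V *m A^T) *m U^T.
  rewrite raddfN /= !trmx_mul -adjmx_tr mulmxN mulmxBl !mulmxA.
  by rewrite -(mulmxA V) UTU mulmx1.
by rewrite frob2_mulr_isometry // frob2_twisted_commutator_le.
Qed.

(** The number x^2 is an eigenvalue of X^* X; a row eigenvector v gives the column w = v^* with |X
    w|^2 = x^2 |w|^2 and w nonzero. *)
Lemma singular_value_sqr_le {R : realType} {n} (X : 'M[R[i]]_n) (s : seq R)
    (x c : R) :
  singular_values X s -> x \in s ->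
  (forall w : 'cV_n, frob2 (X *m w) <= real_complex R c * frob2 w) ->
  x ^+ 2 <= c.
Proof.
move=> [_ _ _ charE] xs Xle.
have : root (char_poly (adjmx X *m X)) (real_complex R (x ^+ 2)).
  rewrite charE -(big_map (fun y => real_complex R (y ^+ 2)) xpredT
    (fun z => 'X - z%:P)) root_prod_XsubC.
  exact: map_f.
rewrite -eigenvalue_root_char => /eigenvalueP[v vE v0].
have w0 : adjmx v != 0.
  by apply: contra_neq v0 => v0; rewrite -[v]adjmxK v0; apply/matrixP => i j;
     rewrite !mxE rmorph0.
have := Xle (adjmx v).
have -> : frob2 (X *m adjmx v) = real_complex R (x ^+ 2) * frob2 (adjmx v).
  rewrite /frob2 adjmxM adjmxK mulmxA -(mulmxA v) vE.
  by rewrite -scalemxAl mxtraceZ.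
by rewrite ler_pM2r ?frob2_gt0 // lecR.
Qed.

Theorem theorem2 (R : realType) (A B : 'M[R[i]]_4) :
  \tr A = 0 -> \tr B = 0 ->
  frob2 A + frob2 B = 4^-1 ->
  (exists U : 'M[R[i]]_4, unitary U /\
     (B = - (U *m A^T *m adjmx U) \/ B = - (U *m A *m adjmx U))) ->
  forall s : seq R,
    singular_values (A *t (1%:M : 'M[R[i]]_4) + (1%:M : 'M[R[i]]_4) *t B) s ->
    s`_0 ^+ 2 + s`_1 ^+ 2 <= 2^-1.
Proof.
move=> _ _ normAB unitAB s sv.
(* The bound on [k] makes the entry a genuine member of [s], not the default 0; the two bounds 1/4
   then sum to 1/2. *)
have sle k : (k < 16)%N -> s`_k ^+ 2 <= 4^-1.
  move=> k16; apply: (singular_value_sqr_le _ _ _ _ sv).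
    by apply: mem_nth; case: sv => ->.
  move=> w; rewrite fmorphV rmorph_nat -normAB.
  exact: frob2_tensor_sum_le.
have := sle 0 isT; have := sle 1 isT; lra.
Qed.
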